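(* Let $k\ge 1$ be an integer, and let $M_k$ be the $k\times k$ matrix, indexed by labels $l_0,\dots,l_{k-1}$, with entries $1$ on the diagonal and immediately above the diagonal and $0$ elsewhere. For every integer $\Delta\ge 2$, the propagation problem described by $M_k$ with initial label $l_0$ on the infinite $\Delta$-regular rooted tree has mending volume up to distance $\lfloor\log_\Delta n\rfloor$ equal to $\Theta(\log^{k} n)$ as $n\to\infty$.
   Context: The infinite $\Delta$-regular rooted tree is the infinite tree with one distinguished root in which every vertex has a (unique) directed path to the root and exactly $\Delta$ children. Propagation problem: a finite label set $\Sigma$ with two special labels, the initial label $l_0$ and the wildcard label $l_-$ ; $\Sigma'=\Sigma\setminus\{l_-\}$; a function $\mu:\Sigma'\times\Sigma'\to\mathbb N$ and an integer $\Delta\ge\max_{l\in\Sigma'}\sum_{l'\in\Sigma'}\mu(l,l')$. On the infinite $\Delta$-regular rooted tree a labeling $\lambda$ is accepted at vertex $v$ iff (a) $\lambda(v)=l_0$ if $v$ is the root, and (b) if $\lambda(v)=l\neq l_-$ then for every $l'\in\Sigma'$ at least $\mu(l,l')$ children of $v$ are labeled $l'$. The problem is described by the matrix $M[l,l']=\mu(l,l')$ indexed by $\Sigma'$. A partial solution is a labeling with values in $\Sigma\sqcup\{\bot\}$ such that every vertex having no $\bot$ in its radius-1 neighborhood (itself, its parent, its children) is accepted. A hole is a vertex labeled $\bot$. A mend of a partial solution $\lambda$ at a hole $v$ is a partial solution $\lambda'$ with $\lambda'(v)\neq\bot$ and $\lambda'(u)\ne\bot$ whenever $\lambda(u)\neq\bot$.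 The mending volume up to distance $d_{\max}$ is $\max_{\lambda,v}\min_{\lambda'}|\{u:\lambda(u)\ne\lambda'(u),\ \mathrm{dist}(u,v)\le d_{\max}\}|$, over partial solutions $\lambda$, holes $v$ of $\lambda$, and mends $\lambda'$ of $\lambda$ at $v$. *)

(* Defs.v *)
From HB Require Import structures.
From mathcomp Require Import all_boot all_order all_algebra finmap.
From mathcomp Require Import all_classical all_reals all_analysis.
Import numFieldNormedType.Exports.

Set Implicit Arguments.
Unset Strict Implicit.
Unset Printing Implicit Defensive.

Local Open Scope classical_set_scope.
Local Open Scope nat_scope.

(* The infinite Delta-regular rooted tree.  A vertex is the word of child
   indices on its directed path to the root: [::] is the root, the parent of
   i :: v is v and the children of v are the i :: v for i : 'I_Delta. *)
Definition vertex (Delta : nat) : choiceType := seq 'I_Delta.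

Definition root {Delta : nat} : vertex Delta := [::].

Definition is_child {Delta : nat} (u v : vertex Delta) : bool :=
  if u is _ :: p then p == v else false.

Definition adjacent {Delta : nat} (u v : vertex Delta) : bool :=
  is_child u v || is_child v u.

(* dist(u, v) <= d: some walk from u to v has at most d edges. *)
Definition dist_le {Delta : nat} (u v : vertex Delta) (d : nat) : Prop :=
  exists2 p : seq (vertex Delta),
    path adjacent u p /\ last u p = v & size p <= d.

(* core_label is Sigma' = Sigma \ {l_-}. *)
Record propagation_problem := PropagationProblem {
  core_label : finType;
  initial_label : core_label;
  mu : core_label -> core_label -> nat;
  degree : nat;
  degree_ge : forall l, \sum_l' mu l l' <= degree }.

Section Propagation.
Variable P : propagation_problem.

(* Sigma, in which None is the wildcard l_-. *)
Definition label : Type := option (core_label P).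

(* Labelings with values in Sigma + {bot}, in which None is bot. *)
Definition partial_labeling : Type := vertex (degree P) -> option label.
Definition bot : option label := None.

Definition has_core_label (lam : partial_labeling) (v : vertex (degree P))
  (l : core_label P) : bool := lam v == Some (Some l).

Definition accepted (lam : partial_labeling) (v : vertex (degree P)) : Prop :=
  (v = root -> has_core_label lam v (initial_label P)) /\
  (forall l, has_core_label lam v l -> forall l',
     mu l l' <= #|[set i : 'I_(degree P) | has_core_label lam (i :: v) l']%SET|).

Definition partial_solution (lam : partial_labeling) : Prop :=
  forall v, lam v <> bot -> (forall u, adjacent v u -> lam u <> bot) ->
    accepted lam v.

Definition hole (lam : partial_labeling) (v : vertex (degree P)) : Prop :=
  lam v = bot.

Definition mend (lam : partial_labeling) (v : vertex (degree P))
    (lam' : partial_labeling) : Prop :=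
  [/\ partial_solution lam', lam' v <> bot &
      forall u, lam u <> bot -> lam' u <> bot].

Definition changed (lam lam' : partial_labeling) (v : vertex (degree P))
    (d : nat) : set (vertex (degree P)) :=
  [set u | lam u <> lam' u /\ dist_le u v d].

(* fset_set is meaningful here by finite_changed below. *)
Definition change_volume (lam lam' : partial_labeling) (v : vertex (degree P))
    (d : nat) : nat :=
  #|` fset_set (changed lam lam' v d)|.

(* m is the minimum of the change volume over the mends of lam at v; in
   particular such mends exist. *)
Definition is_min_change (lam : partial_labeling) (v : vertex (degree P))
    (d m : nat) : Prop :=
  (exists2 lam', mend lam v lam' & change_volume lam lam' v d = m) /\
  (forall lam', mend lam v lam' -> m <= change_volume lam lam' v d).

(* V is the maximum, over the partial solutions lam and the holes v of lam, of
   the minimum above; in particular each of these minima and their maximum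
   exist. *)
Definition is_mending_volume (d V : nat) : Prop :=
  (exists lam v, [/\ partial_solution lam, hole lam v &
     is_min_change lam v d V]) /\
  (forall lam v, partial_solution lam -> hole lam v ->
     exists2 m, is_min_change lam v d m & m <= V).

End Propagation.

Lemma adjacentC Delta (u v : vertex Delta) : adjacent u v = adjacent v u.
Proof. by rewrite /adjacent orbC. Qed.

Lemma finite_neighbours Delta (v : vertex Delta) :
  finite_set [set u : vertex Delta | adjacent v u].
Proof.
apply: (@sub_finite_set _ _
  [set` behead v :: [seq i :: v | i <- enum 'I_Delta]]); last first.
  exact: finite_seq.
move=> u /= /orP[]; first by case: v => //= i p /eqP->; rewrite mem_head.
case: u => //= i p /eqP->; rewrite inE; apply/orP; right.
by apply/mapP; exists i; rewrite ?mem_enum.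
Qed.

Lemma finite_ball Delta (v : vertex Delta) (d : nat) :
  finite_set [set u | dist_le v u d].
Proof.
elim: d v => [|d IH] v.
  apply: (@sub_finite_set _ _ [set v]); last exact: finite_set1.
  by move=> u [[|//] [_ <-]].
apply: (@sub_finite_set _ _
  ([set v] `|` \bigcup_(w in [set w | adjacent v w]) [set u | dist_le w u d])).
  move=> u [[|w p] /= [pp <-] sp]; [by left | right].
  case/andP: pp => vw pp; exists w => //; exists p => //.
rewrite finite_setU; split; first exact: finite_set1.
by apply: bigcup_finite => [|w _]; [exact: finite_neighbours | exact: IH].
Qed.

Lemma dist_leC Delta (u v : vertex Delta) d : dist_le u v d -> dist_le v u d.
Proof.
case=> p [pp <-] sp; exists (rev (belast u p)); last first.
  by rewrite size_rev size_belast.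
split; first by rewrite rev_path; under eq_path do rewrite adjacentC.
by case: p {pp sp} => //= w p; rewrite rev_cons last_rcons.
Qed.

Lemma finite_changed (P : propagation_problem) (lam lam' : partial_labeling P)
  (v : vertex (degree P)) (d : nat) : finite_set (changed lam lam' v d).
Proof.
apply: sub_finite_set (finite_ball v d) => u [_].
exact: dist_leC.
Qed.

(* The problem described by a matrix M; the label l_i is i : 'I_k. *)
Definition matrix_problem (k : nat) (M : 'M[nat]_k) (l0 : 'I_k) (Delta : nat)
    (hM : forall i, \sum_j M i j <= Delta) : propagation_problem :=
  @PropagationProblem 'I_k l0 (fun i j => M i j) Delta hM.

Definition bidiagonal (k : nat) : 'M[nat]_k :=
  \matrix_(i < k, j < k) nat_of_bool (((j : nat) == i) || ((j : nat) == i.+1)).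

Lemma bidiagonal_row_sum (k Delta : nat) :
  2 <= Delta -> forall i, \sum_j bidiagonal k i j <= Delta.
Proof.
move=> hD i; apply: leq_trans hD.
under eq_bigr do rewrite mxE.
rewrite -(big_mkord xpredT (fun j => ((j == i) || (j == i.+1) : nat))).
rewrite -big_mkcond /= sum1_count.
rewrite -size_filter -[2]/(size [:: (i : nat); i.+1]).
apply: uniq_leq_size; first by rewrite filter_uniq // iota_uniq.
by move=> j; rewrite mem_filter !inE => /andP[].
Qed.

(* The problem described by M_k; hk makes l_0 an element of 'I_k. *)
Definition bidiagonal_problem (k : nat) (hk : 1 <= k) (Delta : nat)
    (hD : 2 <= Delta) : propagation_problem :=
  matrix_problem (Ordinal hk) (@bidiagonal_row_sum k Delta hD).

(* Main.v *)
(* Upper bound: superimpose on the given partial solution the canonical solution,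
   and wildcards on the path from the root to the hole v; only the children of
   this skeleton need a further change, to a wildcard.  Within distance d of v
   every skeleton vertex off the path extends the d-th ancestor of v by a binary
   word of length at most 2d with fewer than k ones, and there are O(d^k) of those.
   Lower bound: if the root is the only hole and every other vertex is a wildcard,
   any mend is a solution, in which the core labels contain a copy of the tree of
   binary words with fewer than k ones; about d^k of them have length at most d. *)
Require Import Defs.
From mathcomp Require Import all_boot all_order all_algebra.
From mathcomp Require Import all_classical all_reals all_analysis.
From mathcomp Require Import finmap zify.
Import numFieldNormedType.Exports.

Set Implicit Arguments.
Unset Strict Implicit.
Unset Printing Implicit Defensive.

Local Open Scope classical_set_scope.
Local Open Scope nat_scope.

Import Order.TTheory GRing.Theory Num.Theory.

(** * Counting binary words with few ones *)

(* The words over {a, b} of length at most m with fewer than j letters b. *)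
Fixpoint words (T : Type) (a b : T) (j m : nat) : seq (seq T) :=
  if j is j'.+1 then
    if m is m'.+1 then
      [::] :: map (cons a) (words a b j m') ++ map (cons b) (words a b j' m')
    else [:: [::]]
  else [::].

Lemma mem_words (T : eqType) (a b : T) (j m : nat) (w : seq T) :
  all (pred2 a b) w -> count_mem b w < j -> size w <= m ->
  w \in words a b j m.
Proof.
elim: m j w => [|m IH] [|j] [|x w] //=.
move=> /andP[xab wab] cw sw; rewrite inE mem_cat; apply/orP; right.
case: (eqVneq x b) xab cw => [->|_] /=; last first.
  rewrite orbF => /eqP-> cw; apply/orP; left.
  by apply: map_f; exact: IH.
by move=> _ cw; apply/orP; right; apply: map_f; exact: IH.
Qed.

Lemma words0 (T : Type) (a b : T) (m : nat) : words a b 0 m = [::].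
Proof. by case: m. Qed.

(** The inequality is strict so that the recursion can absorb the empty word. *)
Lemma size_words_le (T : Type) (a b : T) (j m : nat) :
  size (words a b j m) < m.+2 ^ j.
Proof.
elim: m j => [|m IH] [|j] //=; first by rewrite (@ltn_exp2l 2 0).
rewrite size_cat !size_map.
have := IH j.+1; have := IH j; rewrite expnS => h1 h2.
rewrite expnS; apply: (@leq_trans (m.+3 * m.+2 ^ j)); first by nia.
by rewrite leq_mul2l; case: j {IH h1 h2} => // j; rewrite leq_exp2r ?leqnSn ?orbT.
Qed.

Lemma leq_size_words (T : Type) (a b : T) (j m n : nat) :
  m <= n -> size (words a b j m) <= size (words a b j n).
Proof.
elim: n m j => [|n IH] [|m] [|j] //= mn.
by rewrite ltnS !size_cat !size_map leq_add // IH.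
Qed.

(** For each [i < c], the words [a^i b w] with [w] in [words a b j m] form a separate copy of that
    list. *)
Lemma size_words_mul (T : Type) (a b : T) (j m c : nat) :
  c * size (words a b j m) <= size (words a b j.+1 (c + m)).
Proof.
elim: c => [|c IH] //; rewrite mulSn addSn /= size_cat !size_map.
by have := @leq_size_words _ a b j m (c + m) (leq_addl _ _); lia.
Qed.

(** Each further letter [b] can be placed in [c] ways at the cost of [c] in length; [r] is slack for
    a division remainder. *)
Lemma size_words_ge (T : Type) (a b : T) (j c r : nat) :
  c ^ j.+1 <= size (words a b j.+1 (j.+1 * c + r)).
Proof.
elim: j => [|j IH].
  rewrite mul1n expn1; apply: leq_trans (leq_addr r c) _.
  elim: (c + r) => [|n IH] //=.
  by rewrite size_cat !size_map words0 addn0.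
rewrite expnS mulSn -addnA; apply: leq_trans (size_words_mul _ _ _ _ _).
by rewrite leq_mul2l IH orbT.
Qed.

(** * Distances in the rooted tree *)

(** Follow the walk from its end: prepending a step lengthens or shortens [w1], or, when [w1] is
    empty, moves [c] one level up. *)
Lemma dist_le_common_ancestor (Delta : nat) (u v : vertex Delta) (d : nat) :
  dist_le u v d -> exists w1 w2 c : vertex Delta,
    [/\ u = w1 ++ c, v = w2 ++ c & size w1 + size w2 <= d].
Proof.
case=> p [+ <-] {v}; elim: p u d => [|u' p IH] u d /=.
  by move=> _ _; exists [::], [::], u.
case/andP=> uu' pp; case: d => // d; rewrite ltnS => sp.
have [w1 [w2 [c [eu' -> sw]]]] := IH _ _ pp sp.
case/orP: uu'.
  case: u => //= i q /eqP->; exists (i :: w1), w2, c.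
  by rewrite eu'; split => //=; rewrite addSn ltnS.
rewrite eu' /is_child; case: w1 {eu'} sw => [|i w1] /= sw.
  case: c => // i c /eqP<-; exists [::], (rcons w2 i), c.
  by rewrite cat_rcons size_rcons; split.
by move=> /eqP<-; exists w1, w2, c; split => //; lia.
Qed.

Lemma dist_le_root (Delta : nat) (u : vertex Delta) (d : nat) :
  size u <= d -> dist_le u Defs.root d.
Proof.
elim: u d => [|i u IH] [|d] //=; [by exists [::] | by exists [::] |].
move=> /IH[p [pp lp] sp]; exists (u :: p) => //; split => //=.
by rewrite pp /Defs.adjacent /= eqxx.
Qed.

(** * The mend built from the canonical solution *)

Definition child0 (Delta : nat) (hD : 2 <= Delta) : 'I_Delta :=
  Ordinal (ltnW hD).

Definition child1 (Delta : nat) (hD : 2 <= Delta) : 'I_Delta := Ordinal hD.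

(* In the canonical solution a vertex with label l_i has label l_i on child 0 and
   l_(i+1) on child 1, so its core labels sit on the binary words with fewer than
   k ones, and the label counts the ones. *)
Definition in_core (k Delta : nat) (hD : 2 <= Delta) (u : vertex Delta) : bool :=
  all (pred2 (child0 hD) (child1 hD)) u && (count_mem (child1 hD) u < k).

(** Words run from a vertex up to the root, so the suffixes of [v] are [v] and its ancestors. *)
Definition in_skeleton (k Delta : nat) (hD : 2 <= Delta) (v u : vertex Delta) :
    bool :=
  in_core k hD u || suffix u v.

Lemma in_core_parent (k Delta : nat) (hD : 2 <= Delta) i (u : vertex Delta) :
  in_core k hD (i :: u) -> in_core k hD u.
Proof.
by move=> /andP[/= /andP[_ hu] hc]; rewrite /in_core hu (leq_ltn_trans _ hc) ?leq_addl.
Qed.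

Lemma in_skeleton_parent (k Delta : nat) (hD : 2 <= Delta) (v : vertex Delta) i
    (u : vertex Delta) :
  in_skeleton k hD v (i :: u) -> in_skeleton k hD v u.
Proof.
case/orP=> [/in_core_parent hu | /(suffix_trans (suffix_cons _ _)) hu].
  by rewrite /in_skeleton hu.
by rewrite /in_skeleton hu orbT.
Qed.

(* A child of the skeleton outside it becomes a wildcard, since filling holes of
   its parent may impose acceptance on it; a hole there stays a hole, so that
   nothing deeper is affected. *)
Definition mended (k : nat) (hk : 1 <= k) (Delta : nat) (hD : 2 <= Delta)
    (lam : partial_labeling (bidiagonal_problem hk hD)) (v : vertex Delta) :
    partial_labeling (bidiagonal_problem hk hD) :=
  fun u : vertex Delta =>
  if in_core k hD u then
    Some (Some (insubd (Ordinal hk) (count_mem (child1 hD) u)))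
  else if suffix u v then Some None
  else if in_skeleton k hD v (behead u) then omap (fun=> None) (lam u)
  else lam u.

Lemma mended_eq_bot (k : nat) (hk : 1 <= k) (Delta : nat) (hD : 2 <= Delta)
    (lam : partial_labeling (bidiagonal_problem hk hD)) (v u : vertex Delta) :
  ~~ in_skeleton k hD v u -> (mended lam v u == bot _) = (lam u == bot _).
Proof.
rewrite /in_skeleton negb_or => /andP[/negbTE h1 /negbTE h2].
by rewrite /mended h1 h2; case: ifP => // _; case: (lam u).
Qed.

Lemma mended_skeleton (k : nat) (hk : 1 <= k) (Delta : nat) (hD : 2 <= Delta)
    (lam : partial_labeling (bidiagonal_problem hk hD)) (v u : vertex Delta) :
  in_skeleton k hD v u -> mended lam v u <> bot _.
Proof. by rewrite /in_skeleton /mended; case: ifP => //= _ ->. Qed.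

Lemma partial_solution_mended (k : nat) (hk : 1 <= k) (Delta : nat)
    (hD : 2 <= Delta) (lam : partial_labeling (bidiagonal_problem hk hD))
    (v : vertex Delta) :
  partial_solution lam -> partial_solution (mended lam v).
Proof.
move=> sol u nu nadj.
case: (boolP (in_core k hD u)) => [cu|ncu].
  split.
    move=> ->; rewrite /has_core_label /mended /in_core /= hk.
    apply/eqP; congr (Some (Some _)); apply: val_inj.
    by rewrite val_insubd hk.
  move=> l; rewrite /has_core_label {1}/mended cu => /eqP[<-] l'.
  case/andP: (cu) => hu hc.
  (* By [hc] the number of ones is a valid label, so the default of [insubd] is not reached. *)
  rewrite /mu /= mxE val_insubd hc.
  case: (boolP (_ || _)) => // /orP hl' /=.
  rewrite card_gt0; apply/set0Pn.
  case: hl' => [/eqP hl'|/eqP hl'].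
    exists (child0 hD); rewrite inE /has_core_label /mended /in_core /= add0n hu hc /=.
    by apply/eqP; congr (Some (Some _)); apply: val_inj; rewrite val_insubd hc.
  exists (child1 hD); rewrite inE /has_core_label /mended /in_core /= hu /=.
  rewrite add1n -hl' ltn_ord.
  by apply/eqP; congr (Some (Some _)); apply: val_inj; rewrite val_insubd ltn_ord.
(* The root is in the core because [k >= 1], so off the core a wildcard is always accepted. *)
have ur : u <> Defs.root by move=> ur; rewrite ur /in_core /= hk in ncu.
have wild w : mended lam v u = Some None -> accepted (mended lam v) u.
  by move=> e; split => // l; rewrite /has_core_label e.
case: (boolP (suffix u v)) => [su|nsu].
  by apply: wild => //; rewrite /mended (negbTE ncu) su.
case: (boolP (in_skeleton k hD v (behead u))) => [bu|nbu].
  apply: wild => //; move: nu; rewrite /mended (negbTE ncu) (negbTE nsu) bu.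
  by case: (lam u).
(* Now [u] and its parent are off the skeleton: [u] and its children keep their labels. The parent
   may have become a wildcard, but was a hole before iff it is one now, so acceptance carries over
   from [lam]. *)
have nu_skel : ~~ in_skeleton k hD v u by rewrite negb_or ncu.
have eu : mended lam v u = lam u.
  by rewrite /mended (negbTE ncu) (negbTE nsu) (negbTE nbu).
have nchild i : ~~ in_skeleton k hD v (i :: u).
  by apply: contra nu_skel; exact: in_skeleton_parent.
have echild i : mended lam v (i :: u) = lam (i :: u).
  have := nchild i; rewrite /mended negb_or => /andP[/negbTE-> /negbTE->] /=.
  by rewrite (negbTE nu_skel).
have [_ acc] : accepted lam u.
  apply: sol; first by rewrite -eu.
  move=> w uw; have := nadj w uw.
  case/orP: uw.
    case: u {nu nadj ncu ur wild nsu nu_skel eu nchild echild} nbu => //= i p.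
    by move=> nw /eqP <-  h1 /eqP h2; apply: h1; apply/eqP; rewrite mended_eq_bot.
  by case: w => // i w /= /eqP ->; rewrite echild.
split=> // l; rewrite /has_core_label eu => /acc h l'.
apply: leq_trans (h l') _; rewrite leq_eqVlt; apply/orP; left; apply/eqP.
by apply: eq_card => i; rewrite !inE /has_core_label echild.
Qed.

Lemma mend_mended (k : nat) (hk : 1 <= k) (Delta : nat)
    (hD : 2 <= Delta) (lam : partial_labeling (bidiagonal_problem hk hD))
    (v : vertex Delta) :
  partial_solution lam -> mend lam v (mended lam v).
Proof.
move=> sol; split.
- exact: partial_solution_mended.
- by apply: mended_skeleton; rewrite /in_skeleton suffix_refl orbT.
- move=> u; case: (boolP (in_skeleton k hD v u)) => [hu _|hu h].
    exact: mended_skeleton.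
  by move=> /eqP; rewrite mended_eq_bot // => /eqP.
Qed.

(** * Locating the changes near the hole *)

(** If [u = w1 ++ c] and [v = w2 ++ c], then [u] lies at most [size w1 + d - size w2 <= 2d] levels
    below [drop d v]. The path part reaches up to [d.+1] levels because the parent of a changed
    vertex is located by its depth only. *)
Definition change_support (k Delta : nat) (hD : 2 <= Delta) (v : vertex Delta)
    (d : nat) : seq (vertex Delta) :=
  [seq w ++ drop d v | w <- words (child0 hD) (child1 hD) k (d.*2)] ++
  [seq drop j v | j <- iota 0 d.+2].

Lemma changed_mended (k : nat) (hk : 1 <= k) (Delta : nat)
    (hD : 2 <= Delta) (lam : partial_labeling (bidiagonal_problem hk hD))
    (v u : vertex Delta) (d : nat) :
  changed lam (mended lam v) v d u ->
  u \in change_support k hD v d ++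
    [seq i :: p | i <- enum 'I_Delta, p <- change_support k hD v d].
Proof.
case=> neq /dist_le_common_ancestor [w1 [w2 [c [eu ev sw]]]].
(* Ones in [drop d v] only reduce the number left for [w]. *)
have core_mem (w : seq 'I_Delta) : in_core k hD (w ++ drop d v) -> size w <= d.*2 ->
    w ++ drop d v \in change_support k hD v d.
  move=> /andP[]; rewrite all_cat count_cat => /andP[hw _] hc hs.
  rewrite mem_cat; apply/orP; left; apply: (map_f (cat^~ _)); apply: mem_words => //.
  by apply: leq_ltn_trans hc; apply: leq_addr.
have path_mem (p : seq 'I_Delta) : suffix p v -> size v <= size p + d.+1 ->
    p \in change_support k hD v d.
  rewrite suffixE => /eqP <-; rewrite size_drop => hs.
  rewrite mem_cat; apply/orP; right; apply: (map_f (drop^~ v)); rewrite mem_iota.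
  by move: hs; set a := size v; set b := size p; move: a b => a b; lia.
have vd : drop d v = drop (d - size w2) c.
  rewrite ev drop_cat; case: ltnP => // h.
  by have := leq_trans h (leq_trans (leq_addl _ _) sw); rewrite ltnn.
pose w := w1 ++ take (d - size w2) c.
have ew : u = w ++ drop d v by rewrite /w -catA vd cat_take_drop.
have sw' : size w <= d.*2.
  rewrite /w size_cat.
  have : size (take (d - size w2) c) <= d - size w2 by rewrite size_take; case: ltnP.
  by rewrite -addnn; lia.
have su : size v <= size u + d by rewrite eu ev !size_cat /=; move: sw => /=; lia.
case: (boolP (in_core k hD u)) => [cu|ncu].
  by rewrite mem_cat {1}ew core_mem // -ew.
case: (boolP (suffix u v)) => [pu|npu].
  by rewrite mem_cat path_mem // addnS leqW.
case: (boolP (in_skeleton k hD v (behead u))) => [bu|nbu]; last first.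
  by case: neq; rewrite /mended (negbTE ncu) (negbTE npu) (negbTE nbu).
(* An empty [w] would make [u] an ancestor of [v], so [u] has its parent still at or below
   [drop d v]. *)
case: w ew sw' => [ew|i w ew sw'].
  by rewrite ew /= suffix_drop in npu.
rewrite mem_cat; apply/orP; right.
rewrite ew /=; apply/allpairsP; exists (i, w ++ drop d v) => /=.
rewrite mem_enum; split => //.
move: bu; rewrite ew /= => /orP[h|h]; first by apply: core_mem => //; exact: ltnW.
by apply: path_mem => //; rewrite addnS -addSn -[_.+1]/(size (i :: _)) -cat_cons -ew.
Qed.

(** * Change volumes and existence of the mending volume *)

Lemma change_volume_le (P : propagation_problem) (lam lam' : partial_labeling P)
    (v : vertex (degree P)) (d : nat) (s : seq (vertex (degree P))) :
  changed lam lam' v d `<=` [set` s] -> change_volume lam lam' v d <= size s.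
Proof.
move=> sub; apply: uniq_leq_size; first exact: fset_uniq.
move=> u; rewrite in_fset_set; last exact: finite_changed.
by move=> /set_mem /sub.
Qed.

Lemma change_volume_ge (P : propagation_problem) (lam lam' : partial_labeling P)
    (v : vertex (degree P)) (d : nat) (s : seq (vertex (degree P))) :
  uniq s -> [set` s] `<=` changed lam lam' v d ->
  size s <= change_volume lam lam' v d.
Proof.
move=> us sub; apply: uniq_leq_size => // u us'.
rewrite in_fset_set; last exact: finite_changed.
by apply/mem_set/sub.
Qed.

Lemma exists_min_change (P : propagation_problem) (lam lam0 : partial_labeling P)
    (v : vertex (degree P)) (d : nat) :
  mend lam v lam0 ->
  exists2 m, is_min_change lam v d m & m <= change_volume lam lam0 v d.
Proof.
move=> h0.
pose A m := `[< exists2 lam', mend lam v lam' & change_volume lam lam' v d = m >].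
have exA : exists m, A m.
  by exists (change_volume lam lam0 v d); apply/asboolP; exists lam0.
case: (ex_minnP exA) => m /asboolP mA mmin; exists m.
  by split => // lam' h'; apply: mmin; apply/asboolP; exists lam'.
by apply: mmin; apply/asboolP; exists lam0.
Qed.

(** One cheap mend per hole bounds every minimum by [B], and a nonempty bounded set of naturals has
    a maximum. *)
Lemma exists_mending_volume (P : propagation_problem) (d B : nat) :
  (forall (lam : partial_labeling P) v, partial_solution lam -> hole lam v ->
    exists2 lam', mend lam v lam' & change_volume lam lam' v d <= B) ->
  exists2 V, is_mending_volume P d V & V <= B.
Proof.
move=> hB.
have hm (lam : partial_labeling P) v : partial_solution lam -> hole lam v ->
    exists2 m, is_min_change lam v d m & m <= B.
  move=> ls lv; have [lam' h' le'] := hB _ _ ls lv.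
  have [m hm le_m] := exists_min_change d h'; exists m => //.
  exact: leq_trans le'.
pose A m := `[< exists (lam : partial_labeling P) v,
  [/\ partial_solution lam, hole lam v & is_min_change lam v d m] >].
have boundA m : A m -> m <= B.
  move=> /asboolP[lam [v [ls lv [[lam' h' <-] hmin]]]].
  by have [lam'' h'' le''] := hB _ _ ls lv; apply: leq_trans (hmin _ h'') le''.
have exA : exists m, A m.
  (* The labeling with holes everywhere is vacuously a partial solution, so the set of minima is
     nonempty. *)
  have ls : partial_solution (fun=> bot P : option (label P)) by [].
  have [m mm _] := hm _ Defs.root ls erefl.
  by exists m; apply/asboolP; exists (fun=> bot P), Defs.root.
case: (ex_maxnP exA boundA) => V VA Vmax; exists V; last exact: boundA.
split; first exact/asboolP.
move=> lam v ls lv; have [m mm _] := hm _ _ ls lv; exists m => //.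
by apply: Vmax; apply/asboolP; exists lam, v.
Qed.

(** * The upper bound *)

(** The words contribute [(2d+2)^k = 2^k (d+1)^k], the path [d+2 <= 2(d+1)^k]. *)
Lemma size_change_support_le (k Delta : nat) (hk : 1 <= k) (hD : 2 <= Delta)
    (v : vertex Delta) (d : nat) :
  size (change_support k hD v d) <= (2 ^ k + 2) * d.+1 ^ k.
Proof.
rewrite size_cat !size_map size_iota mulnDl -expnMn; apply: leq_add.
  apply: leq_trans (ltnW (size_words_le _ _ _ _)) _.
  by rewrite mul2n doubleS.
apply: (@leq_trans (2 * d.+1)); first by lia.
by rewrite leq_mul2l -{1}[d.+1]expn1 leq_pexp2l.
Qed.

Lemma mending_volume_le (k : nat) (hk : 1 <= k) (Delta : nat) (hD : 2 <= Delta)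
    (d : nat) :
  exists2 V, is_mending_volume (bidiagonal_problem hk hD) d V &
    V <= Delta.+1 * (2 ^ k + 2) * d.+1 ^ k.
Proof.
apply: exists_mending_volume => lam v ls lv.
exists (mended lam v); first exact: mend_mended.
apply: leq_trans (change_volume_le _) _.
  by move=> u; exact: changed_mended.
(* The factor [Delta.+1] counts each support vertex with its children. *)
rewrite size_cat size_allpairs size_enum_ord -mulSn -mulnA leq_mul2l.
by rewrite size_change_support_le // orbT.
Qed.

(** * The lower bound *)

(** The letter of [u] just before its suffix [x] is determined by [u]; hence distinct children of
    [x] have disjoint subtrees. *)
Lemma suffix_cons_inj (T : eqType) (i i' : T) (x u : seq T) :
  suffix (i :: x) u -> suffix (i' :: x) u -> i = i'.
Proof.
move=> /suffixP[s ->] /suffixP[s' /eqP].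
rewrite -!cat_rcons => e; have := congr1 size (eqP e).
rewrite !size_cat => /addIn es; move: e; rewrite eqseq_cat // => /andP[/eqP e _].
by have [] := rcons_inj e.
Qed.

(** A vertex labeled [l] has a child labeled [l] (letter [false]) and, if [j > 1], one labeled
    [l + 1] (letter [true]), matching the recursion of [words]. The solution chooses which children
    these are, so the copy is only asserted to exist. *)
Lemma core_subtree (k : nat) (hk : 1 <= k) (Delta : nat) (hD : 2 <= Delta)
    (lam : partial_labeling (bidiagonal_problem hk hD)) :
  (forall u, accepted lam u) ->
  forall (m j : nat) (x : vertex Delta) (l : 'I_k),
    lam x = Some (Some l) -> l + j = k ->
  exists s : seq (vertex Delta), [/\ uniq s,
    size s = size (words false true j m) &
    forall u, u \in s ->
      [/\ suffix x u, size u <= size x + m & lam u <> Some None]].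
Proof.
move=> acc; elim=> [|m IH] [|j] x l xl lj.
- by have := ltn_ord l; move: lj; rewrite addn0 => ->; rewrite ltnn.
- exists [:: x]; split => // u; rewrite inE => /eqP->.
  by rewrite suffix_refl addn0 xl.
- by have := ltn_ord l; move: lj; rewrite addn0 => ->; rewrite ltnn.
have child (l' : 'I_k) : ((l' : nat) == l) || ((l' : nat) == l.+1) ->
    exists i, lam (i :: x) = Some (Some l').
  move=> ll'; have [_ /(_ l _ l')] := acc x.
  rewrite /has_core_label xl eqxx => /(_ erefl).
  rewrite /mu /= mxE ll' => /=; rewrite card_gt0 => /set0Pn[i].
  by rewrite inE => /eqP; exists i.
have [i1 xi1] : exists i, lam (i :: x) = Some (Some l).
  by apply: child; rewrite eqxx.
have [s1 [us1 ss1 hs1]] := IH j.+1 _ _ xi1 lj.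
have [s2 [us2 ss2 hs2 d12]] : exists s2 : seq (vertex Delta), [/\ uniq s2,
    size s2 = size (words false true j m),
    forall u, u \in s2 ->
      [/\ suffix x u, size x < size u <= size x + m.+1 & lam u <> Some None] &
    forall u, u \in s1 -> u \in s2 -> False].
  case: j lj {ss1} => [|j] lj; first by exists [::]; rewrite words0.
  have hl : l.+1 < k by lia.
  have [i2 xi2] : exists i, lam (i :: x) = Some (Some (Ordinal hl)).
    by apply: child; rewrite eqxx orbT.
  have lj2 : Ordinal hl + j.+1 = k by rewrite /=; lia.
  have [s2 [us2 ss2 hs2]] := IH j.+1 _ _ xi2 lj2.
  exists s2; split => //.
    move=> u /hs2[h1 h2 h3]; split => //.
      exact: suffix_trans (suffix_cons _ _) h1.
    by move: h2; rewrite /= addSnnS => ->; rewrite andbT; exact: size_suffix h1.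
  (* A common vertex would force the two children to coincide, yet their labels differ. *)
  move=> u /hs1[h1 _ _] /hs2[h2 _ _].
  move: xi2; rewrite -(suffix_cons_inj h1 h2) xi1 => -[] /(congr1 val) /=.
  by move/eqP; rewrite ltn_eqF.
have hs1' u : u \in s1 ->
    [/\ suffix x u, size x < size u <= size x + m.+1 & lam u <> Some None].
  move=> /hs1[h1 h2 h3]; split => //.
    exact: suffix_trans (suffix_cons _ _) h1.
  by move: h2; rewrite /= addSnnS => ->; rewrite andbT; exact: size_suffix h1.
exists (x :: s1 ++ s2); split.
- rewrite /= cat_uniq us1 us2 /= andbT mem_cat negb_or.
  apply/andP; split; first apply/andP; try split.
  + by apply/negP => /hs1'[_]; rewrite ltnn.
  + by apply/negP => /hs2[_]; rewrite ltnn.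
  + by apply/hasPn => u u2; apply/negP => u1; exact: d12 u1 u2.
- by rewrite /= !size_cat !size_map ss1 ss2.
- move=> u; rewrite inE mem_cat => /orP[/eqP->|/orP[/hs1'|/hs2]].
  + by rewrite suffix_refl leq_addr xl.
  + by case=> h1 /andP[_ h2] h3.
  + by case=> h1 /andP[_ h2] h3.
Qed.

Lemma size_words_le_mending_volume (k : nat) (hk : 1 <= k) (Delta : nat)
    (hD : 2 <= Delta) (d V : nat) :
  is_mending_volume (bidiagonal_problem hk hD) d V ->
  size (words false true k d) <= V.
Proof.
case=> _ maxV.
pose lam : partial_labeling (bidiagonal_problem hk hD) :=
  fun u => if u == Defs.root then None else Some None.
have ls : partial_solution lam.
  move=> v nv _; split=> [vr|l]; first by rewrite vr /lam eqxx in nv.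
  by rewrite /has_core_label /lam; case: ifP.
have [m [[lam' [sol' r' nb'] <-] _]] :
    exists2 m, is_min_change lam Defs.root d m & m <= V.
  by apply: maxV => //; rewrite /hole /lam eqxx.
apply: leq_trans.
have nb u : lam' u <> bot _.
  case: (eqVneq u Defs.root) => [->//|nu]; apply: nb'.
  by rewrite /lam (negbTE nu).
have acc u : accepted lam' u by apply: sol' => // w _.
have r0 : lam' Defs.root = Some (Some (Ordinal hk)).
  by have [/(_ erefl) /eqP] := acc Defs.root.
have [s [us <- hs]] := core_subtree acc d r0 (add0n k : Ordinal hk + k = k).
apply: change_volume_ge => // u /= /hs[_ ud nw]; split.
  by rewrite /lam; case: ifP => _ e; [exact: (nb u) | exact: nw].
exact: dist_le_root.
Qed.

(** With [q = d %/ k >= 1], one has [d + 1 <= k (q + 1) <= 2 k q]. *)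
Lemma succ_le_mul_divn (k d : nat) : 0 < k -> k <= d -> d.+1 <= 2 * k * (d %/ k).
Proof.
move=> k0 kd; have q0 : 0 < d %/ k by rewrite divn_gt0.
have := ltn_ceil d k0; nia.
Qed.

Lemma mending_volume_ge (k : nat) (hk : 1 <= k) (Delta : nat)
    (hD : 2 <= Delta) (d V : nat) :
  k <= d -> is_mending_volume (bidiagonal_problem hk hD) d V ->
  d.+1 ^ k <= (2 * k) ^ k * V.
Proof.
move=> kd /size_words_le_mending_volume hV.
apply: (@leq_trans ((2 * k) ^ k * (d %/ k) ^ k)).
  by rewrite -expnMn leq_exp2r // succ_le_mul_divn.
rewrite leq_mul2l; apply/orP; right; apply: leq_trans hV.
case: k hk {kd} => // j _.
rewrite {2}(divn_eq d j.+1) mulnC; exact: size_words_ge.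
Qed.

(** * From distances to powers of the logarithm *)

Lemma trunc_log_ln_bounds (R : realType) (Delta n : nat) :
  2 <= Delta -> 0 < n ->
  ((trunc_log Delta n)%:R * ln Delta%:R <= ln (n%:R : R) <=
   (trunc_log Delta n).+1%:R * ln Delta%:R)%R.
Proof.
move=> hD n0; have D0 : 0 < Delta by exact: ltnW.
rewrite !mulr_natl -!lnXn ?ltr0n // !ler_ln ?posrE ?exprn_gt0 ?ltr0n //.
by rewrite -!natrX !ler_nat trunc_logP // ltnW // trunc_log_ltn.
Qed.

Local Open Scope ring_scope.

Theorem mainTheorem3 (R : realType) (k : nat) (hk : (1 <= k)%N)
    (Delta : nat) (hD : (2 <= Delta)%N) :
  exists vol : nat -> nat,
    (forall d, is_mending_volume (bidiagonal_problem hk hD) d (vol d)) /\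
    (fun n : nat => (vol (trunc_log Delta n))%:R : R)
      \is 'Theta_\oo (fun n : nat => ln (n%:R : R) ^+ k).
Proof.
have hvol d : exists V, is_mending_volume (bidiagonal_problem hk hD) d V /\
    (V <= Delta.+1 * (2 ^ k + 2) * d.+1 ^ k)%N.
  by have [V h1 h2] := mending_volume_le hk hD d; exists V.
have [vol hv] := choice hvol.
exists vol; split=> [d|]; first exact: (hv d).1.
have L0 : 0 < ln Delta%:R :> R by rewrite ln_gt0 // ltr1n.
pose C := (Delta.+1 * (2 ^ k + 2))%N.
(* [c1] combines [(d+1)^k <= (2k)^k V] with [ln n <= (d+1) ln Delta]; [c2] combines
   [V <= C (d+1)^k <= C (2d)^k] with [d ln Delta <= ln n]. *)
pose c1 : R := (((2 * k)%:R * ln Delta%:R) ^+ k)^-1.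
pose c2 : R := C%:R * (2 / ln Delta%:R) ^+ k.
rewrite qualifE; apply/asboolP; exists (c1, c2) => /=.
  apply/andP; split.
    by rewrite invr_gt0 exprn_gt0 // mulr_gt0 // ltr0n muln_gt0.
  by rewrite mulr_gt0 ?exprn_gt0 ?divr_gt0 // ltr0n muln_gt0 addn_gt0 expn_gt0.
near=> n.
(* This gives [d >= k >= 1], as required by [mending_volume_ge] and by [d + 1 <= 2 d]. *)
have nk : (Delta ^ k <= n)%N by near: n; exact: nbhs_infty_ge.
have n0 : (0 < n)%N by apply: leq_trans nk; rewrite expn_gt0 ltnW.
set d := trunc_log Delta n.
have kd : (k <= d)%N by exact: trunc_log_max.
have /andP[lo hi] := trunc_log_ln_bounds R hD n0.
have x0 : 0 <= ln (n%:R : R) by rewrite ln_ge0 // ler1n.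
rewrite !ger0_norm ?exprn_ge0 //; split.
  rewrite ler_pdivrMl; last by rewrite exprn_gt0 // mulr_gt0 // ltr0n muln_gt0.
  apply: (@le_trans _ _ ((d.+1%:R * ln Delta%:R) ^+ k)).
    by rewrite lerXn2r // nnegrE mulr_ge0 // ltW.
  rewrite !exprMn mulrAC ler_pM2r ?exprn_gt0 // -!natrX -natrM ler_nat.
  exact: mending_volume_ge kd (hv d).1.
apply: (@le_trans _ _ (C%:R * (2 * d%:R) ^+ k)).
  rewrite -natrM -natrX -natrM ler_nat; apply: leq_trans (hv d).2 _.
  by rewrite leq_mul2l leq_exp2r //; apply/orP; right; lia.
rewrite -mulrA ler_pM2l; last first.
  by rewrite ltr0n muln_gt0 addn_gt0 expn_gt0.
have le_dln : 2 * d%:R <= 2 / ln Delta%:R * ln (n%:R : R).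
  by rewrite -mulrA ler_pM2l // [_^-1 * _]mulrC ler_pdivlMr.
have d2 : 0 <= 2 * d%:R :> R by rewrite mulr_ge0.
by rewrite -exprMn lerXn2r // nnegrE (le_trans d2).
Unshelve. all: by end_near. Qed.
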